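(* There exists a transcendental entire function $f$ of zero lower order and positive, finite order (i.e. $\lambda(f)=0$ and $0<\rho(f)<\infty$) which is strongly log-regular.
   Context: For a transcendental entire function $f$, $M(r)=M(r,f)=\max_{|z|=r}|f(z)|$ for $r>0$. Order and lower order: $\rho(f)=\limsup_{r\to\infty}\frac{\log\log M(r,f)}{\log r}$, $\lambda(f)=\liminf_{r\to\infty}\frac{\log\log M(r,f)}{\log r}$. A transcendental entire function $f$ is strongly log-regular if, for every $\varepsilon\in(0,1)$, there exist $R>0$ and $k>1$ such that $\log M(r^k,f)\ge(k\log M(r,f))^{1/\varepsilon}$ for all $r>R$. *)

(* Defs.v *)
From Stdlib Require Import Reals Lra.
From Coquelicot Require Import Coquelicot.
Open Scope R_scope.

(** Complex differentiability at every point of the plane. *)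
Definition entire (f : C -> C) : Prop :=
  forall z : C, ex_derive (K := C_AbsRing) (V := C_NormedModule) f z.

Definition is_polynomial (f : C -> C) : Prop :=
  exists (n : nat) (a : nat -> C),
    forall z : C, f z = sum_n (fun k => a k * z ^ k)%C n.

(** An entire function is transcendental exactly when it is not a polynomial;
    this is the usual convention in function theory. *)
Definition transcendental_entire (f : C -> C) : Prop :=
  entire f /\ ~ is_polynomial f.

(** [M(r,f)].  Written with the total supremum operator; for entire [f] and
    [r > 0] the supremum is a maximum, see [max_modulus_attained] below. *)
Definition max_modulus (f : C -> C) (r : R) : R :=
  real (Lub_Rbar (fun x => exists z : C, Cmod z = r /\ x = Cmod (f z))).

Lemma entire_continuous (f : C -> C) (z : C) :
  entire f -> continuous (T := C_UniformSpace) (U := C_UniformSpace) f z.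
Proof.
intros Hf P HP.
apply locally_C.
exact (ex_derive_continuous (K := C_AbsRing) (V := C_NormedModule) f z (Hf z) P HP).
Qed.

Lemma Cmod_f_arc (f : C -> C) (r s : R) :
  entire f -> 0 < r ->
  exists x0, -r <= x0 <= r /\ forall x, -r <= x <= r ->
    Cmod (f (x, s * sqrt (r ^ 2 - x ^ 2))) <= Cmod (f (x0, s * sqrt (r ^ 2 - x0 ^ 2))).
Proof.
intros Hf Hr.
destruct (continuity_ab_maj
  (fun x => Cmod (f (x, s * sqrt (r ^ 2 - x ^ 2)))) (-r) r) as [x0 [H1 H2]].
- lra.
- intros c _. apply continuity_pt_filterlim.
  apply (continuous_comp (U := R_UniformSpace) (V := C_UniformSpace) (W := R_UniformSpace)
    (fun x => f (x, s * sqrt (r ^ 2 - x ^ 2))) Cmod).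
  + apply (continuous_comp (U := R_UniformSpace) (V := C_UniformSpace) (W := C_UniformSpace)
      (fun x => (x, s * sqrt (r ^ 2 - x ^ 2))) f).
    * apply (continuous_comp_2 (U := R_UniformSpace) (V := R_UniformSpace)
        (W := R_UniformSpace) (X := C_UniformSpace)
        (fun x => x) (fun x => s * sqrt (r ^ 2 - x ^ 2)) (fun x y => (x, y))).
      -- apply continuous_id.
      -- apply (continuous_mult (K := R_AbsRing)). apply continuous_const.
         apply continuous_comp; [|apply continuous_sqrt].
         apply (ex_derive_continuous (K := R_AbsRing) (V := R_NormedModule)).
         auto_derive. trivial.
      -- intros P HP. apply filter_imp with (2 := HP). intros [u v]. trivial.
    * apply entire_continuous, Hf.
  + apply (filterlim_norm (K := C_AbsRing) (V := C_NormedModule)).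
- exists x0. split; [exact H2|]. exact H1.
Qed.

Lemma Cmod_arc (r x s : R) : 0 < r -> -r <= x <= r -> s ^ 2 = 1 ->
  Cmod (x, s * sqrt (r ^ 2 - x ^ 2)) = r.
Proof.
intros Hr Hx Hs. unfold Cmod, fst, snd.
rewrite Rpow_mult_distr, Hs, pow2_sqrt by nra.
replace (x ^ 2 + 1 * (r ^ 2 - x ^ 2)) with (r ^ 2) by ring.
apply sqrt_pow2. lra.
Qed.

Lemma arc_cover (r : R) (z : C) : Cmod z = r ->
  -r <= fst z <= r /\
  (z = (fst z, 1 * sqrt (r ^ 2 - fst z ^ 2)) \/ z = (fst z, -1 * sqrt (r ^ 2 - fst z ^ 2))).
Proof.
intros <-. destruct z as [x y]. 
assert (E : Cmod (x, y) ^ 2 = x ^ 2 + y ^ 2).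
{ unfold Cmod. apply pow2_sqrt. simpl. nra. }
pose proof (Cmod_ge_0 (x, y)) as H0.
rewrite E. unfold fst. split. { split; nra. }
replace (x ^ 2 + y ^ 2 - x ^ 2) with (y ^ 2) by ring.
replace (sqrt (y ^ 2)) with (Rabs y) by (rewrite <- sqrt_Rsqr_abs; f_equal; unfold Rsqr; ring).
unfold Rabs; destruct (Rcase_abs y); [right|left]; f_equal; ring.
Qed.

Lemma max_modulus_attained (f : C -> C) (r : R) :
  entire f -> 0 < r ->
  (exists z : C, Cmod z = r /\ Cmod (f z) = max_modulus f r) /\
  (forall z : C, Cmod z = r -> Cmod (f z) <= max_modulus f r).
Proof.
intros Hf Hr.
assert (H : exists z0, Cmod z0 = r /\ forall z, Cmod z = r -> Cmod (f z) <= Cmod (f z0)).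
{ destruct (Cmod_f_arc f r 1 Hf Hr) as [x1 [I1 M1]].
  destruct (Cmod_f_arc f r (-1) Hf Hr) as [x2 [I2 M2]].
  pose proof (Cmod_arc r x1 1 Hr I1 ltac:(ring)) as E1.
  pose proof (Cmod_arc r x2 (-1) Hr I2 ltac:(ring)) as E2.
  set (z1 := (x1, 1 * sqrt (r ^ 2 - x1 ^ 2))) in *.
  set (z2 := (x2, -1 * sqrt (r ^ 2 - x2 ^ 2))) in *.
  assert (A : forall z, Cmod z = r ->
    Cmod (f z) <= Cmod (f z1) \/ Cmod (f z) <= Cmod (f z2)).
  { intros z Hz. destruct (arc_cover r z Hz) as [I [E | E]]; rewrite E; [left|right];
    [apply M1 | apply M2]; exact I. }
  destruct (Rle_dec (Cmod (f z1)) (Cmod (f z2))).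
  - exists z2. split; [exact E2|]. intros z Hz. destruct (A z Hz); lra.
  - exists z1. split; [exact E1|]. intros z Hz. destruct (A z Hz); lra. }
destruct H as [z0 [E0 M0]].
replace (max_modulus f r) with (Cmod (f z0)).
- split; [exists z0; auto | exact M0].
- unfold max_modulus.
  rewrite (is_lub_Rbar_unique _ (Finite (Cmod (f z0)))); [reflexivity|].
  split.
  + intros x [z [Hz ->]]. exact (M0 z Hz).
  + intros b Hb. apply Hb. exists z0. auto.
Qed.

(** Upper and lower limits at [+oo] of a real function, with values in the
    extended reals: [inf_A sup_{r > A} g r] and [sup_A inf_{r > A} g r]. *)
Definition LimSup_p_infty (g : R -> R) : Rbar :=
  Rbar_glb (fun y => exists A : R,
    y = Lub_Rbar (fun x => exists r : R, A < r /\ x = g r)).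

Definition LimInf_p_infty (g : R -> R) : Rbar :=
  Rbar_lub (fun y => exists A : R,
    y = Glb_Rbar (fun x => exists r : R, A < r /\ x = g r)).

(** [ln] is totalized by [ln x = 0] for [x <= 0].  For transcendental entire
    [f], [M(r,f)] tends to [+oo], so this affects only bounded ranges of [r],
    which are irrelevant to the three notions below. *)
Definition order (f : C -> C) : Rbar :=
  LimSup_p_infty (fun r => ln (ln (max_modulus f r)) / ln r).

Definition lower_order (f : C -> C) : Rbar :=
  LimInf_p_infty (fun r => ln (ln (max_modulus f r)) / ln r).

Definition strongly_log_regular (f : C -> C) : Prop :=
  forall eps : R, 0 < eps < 1 ->
    exists R0 k : R, 0 < R0 /\ 1 < k /\
      forall r : R, R0 < r ->
        ln (max_modulus f (Rpower r k))
          >= Rpower (k * ln (max_modulus f r)) (1 / eps).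

(* Main.v *)
Require Import Defs.
From Stdlib Require Import Reals Lra Lia ClassicalEpsilon.
From Coquelicot Require Import Coquelicot.
Open Scope R_scope.

(** Take [f(z) = sum_k (z / R_k)^(N_k)] with [R_k = 2^(4^k)] and
    [N_k = 2^(L_k)].  The coefficients are nonnegative, so [M(r,f) = f(r)], and
    between [R_k] and [R_(k+1)] the largest term governs the growth: up to
    factors which are negligible after a second logarithm,
    [log log M(r,f)] lies between [L_(k-1)] and [L_k], while [log r] is
    comparable to [4^k].

    Choose [L_k = 2^(k + s)] with [s] the largest square [<= k].  At [k = n^2]
    this is [4^k], which gives positive order; at [k = n^2 + 2n] it is
    [4^k / 4^n], which gives zero lower order.  Since always
    [L_(k+p) >= 2^p L_k], raising [r] to the power [4^(p+1)] multiplies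
    [log log M] by about [2^p], whatever [k]: this is strong log-regularity. *)

(** * Entire series with nonnegative coefficients and their maximum modulus *)

Lemma Cmod_series_le (u : nat -> C) (v : nat -> R) (l : C) (s : R) :
  (forall n, Cmod (u n) <= v n) ->
  is_series (K := C_AbsRing) (V := C_NormedModule) u l ->
  is_series v s -> Cmod l <= s.
Proof.
intros Huv Hu Hv.
apply (is_lim_seq_le
  (fun n => norm (K := C_AbsRing) (V := C_NormedModule) (sum_n u n))
  (sum_n v) (Cmod l) s).
- intros n. eapply Rle_trans.
  + apply (norm_sum_n_m (K := C_AbsRing) (V := C_NormedModule) u 0 n).
  + apply sum_n_m_le. exact Huv.
- exact (filterlim_comp _ _ _ _ _ _ _ _ Hu
    (filterlim_norm (K := C_AbsRing) (V := C_NormedModule) l)).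
- exact Hv.
Qed.

(** By induction: the remainder for n + 1 is w times the remainder for n plus n z^(n-1) (w - z)^2,
    and n^2 + n <= (n + 1)^2. The bound depends on w only through |w - z|, so it can be summed over
    the series. *)
Lemma pow_taylor2 (w z : C) (rho : R) (n : nat) :
  1 <= rho -> Cmod z <= rho -> Cmod w <= rho ->
  Cmod (w ^ n - z ^ n - RtoC (INR n) * z ^ pred n * (w - z))%C
    <= INR n ^ 2 * rho ^ n * Cmod (w - z)%C ^ 2.
Proof.
intros Hrho Hz Hw. induction n as [|n IHn].
{ replace (w ^ 0 - z ^ 0 - RtoC (INR 0) * z ^ pred 0 * (w - z))%C with (RtoC 0)
    by (simpl; ring).
  rewrite Cmod_0. simpl. lra. }
replace (w ^ S n - z ^ S n - RtoC (INR (S n)) * z ^ pred (S n) * (w - z))%C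
  with (w * (w ^ n - z ^ n - RtoC (INR n) * z ^ pred n * (w - z))
        + RtoC (INR n) * z ^ pred n * ((w - z) * (w - z)))%C.
2:{ rewrite S_INR, RtoC_plus. destruct n; simpl; ring. }
eapply Rle_trans; [apply Cmod_triangle|]. rewrite !Cmod_mult, Cmod_pow, Cmod_R.
rewrite (Rabs_pos_eq (INR n)) by apply pos_INR.
set (h := Cmod (w - z)%C) in *.
assert (Hh : 0 <= h) by apply Cmod_ge_0.
assert (P : Cmod z ^ pred n <= rho ^ n).
{ apply Rle_trans with (rho ^ pred n).
  - apply pow_incr. split; [apply Cmod_ge_0|exact Hz].
  - apply Rle_pow; [exact Hrho|lia]. }
assert (Q : 0 <= Cmod z ^ pred n) by (apply pow_le, Cmod_ge_0).
pose proof (pos_INR n) as Hn. rewrite S_INR.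
assert (Pn : 0 < rho ^ n) by (apply pow_lt; lra).
assert (A1 : Cmod w * Cmod (w ^ n - z ^ n - RtoC (INR n) * z ^ pred n * (w - z))
   <= rho * (INR n ^ 2 * rho ^ n * h ^ 2)).
{ apply Rmult_le_compat; auto using Cmod_ge_0. }
assert (A2 : INR n * Cmod z ^ pred n * (h * h) <= INR n * (rho * rho ^ n) * (h * h)).
{ apply Rmult_le_compat_r; [nra|]. apply Rmult_le_compat_l; [lra|]. nra. }
simpl pow at 1.
assert (A3 : 0 <= rho * rho ^ n * (h * h)) by (apply Rmult_le_pos; nra).
simpl in A1 |- *. nra.
Qed.

(** Absorbs the factor n^2 of the Taylor remainder into a larger radius, n^2 rho^n <= (4 rho)^n,
    where the series still converges. *)
Lemma INR_sqr_le_4_pow (n : nat) : INR n ^ 2 <= 4 ^ n.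
Proof.
replace 4 with (2 ^ 2) by ring. rewrite <- pow_mult, Nat.mul_comm, pow_mult.
apply pow_incr. split; [apply pos_INR|].
induction n as [|n IHn]; [simpl; lra|]. rewrite S_INR. simpl.
pose proof (pow_R1_Rle 2 n ltac:(lra)). lra.
Qed.

Section GapSeries.

Context (c : nat -> R) (N : nat -> nat) (f : C -> C)
  (c_ge0 : forall k, 0 <= c k)
  (conv : forall rho, 0 <= rho -> ex_series (fun k => c k * rho ^ N k))
  (f_sum : forall z, is_series (K := C_AbsRing) (V := C_NormedModule)
    (fun k => RtoC (c k) * z ^ N k)%C (f z)).

Lemma Cmod_gap_term (z : C) (k : nat) :
  Cmod (RtoC (c k) * z ^ N k)%C = c k * Cmod z ^ N k.
Proof. rewrite Cmod_mult, Cmod_pow, Cmod_R, Rabs_pos_eq; auto. Qed.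

(** The derivative is the termwise one: summing [pow_taylor2] over the terms bounds the remainder by
    B |w - z|^2, with B the sum of [b]. *)
Lemma entire_gap_series : entire f.
Proof.
(* The disc of radius [rho] about 0 contains the unit disc about z, where the Taylor bound is
   applied. *)
intros z. set (rho := Cmod z + 1).
assert (Hz0 := Cmod_ge_0 z).
set (b := fun k => c k * (INR (N k) ^ 2 * rho ^ N k)).
assert (Hb0 : forall k, 0 <= b k).
{ intros k. apply Rmult_le_pos; auto.
  apply Rmult_le_pos; apply pow_le; [apply pos_INR|unfold rho; lra]. }
assert (Hb : ex_series b).
{ apply (ex_series_le (K := R_AbsRing) (V := R_CompleteNormedModule))
    with (fun k => c k * (4 * rho) ^ N k).
  2: apply conv; unfold rho; lra.
  intros k. change (Rabs (b k) <= c k * (4 * rho) ^ N k).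
  rewrite Rabs_pos_eq by auto. apply Rmult_le_compat_l; auto.
  rewrite Rpow_mult_distr. apply Rmult_le_compat_r.
  - apply pow_le. unfold rho; lra.
  - apply INR_sqr_le_4_pow. }
assert (Hd : ex_series (K := C_AbsRing) (V := C_NormedModule)
  (fun k => RtoC (c k) * (RtoC (INR (N k)) * z ^ pred (N k)))%C).
{ apply (ex_series_le (K := C_AbsRing) (V := C_CompleteNormedModule)) with b; [|exact Hb].
  intros k. change (Cmod (RtoC (c k) * (RtoC (INR (N k)) * z ^ pred (N k)))%C <= b k).
  rewrite !Cmod_mult, Cmod_pow, !Cmod_R, !Rabs_pos_eq; auto using pos_INR.
  apply Rmult_le_compat_l; auto.
  assert (I : INR (N k) <= INR (N k) ^ 2).
  { destruct (N k) as [|m]; [simpl; lra|]. rewrite S_INR. pose proof (pos_INR m). nra. }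
  apply Rmult_le_compat; auto using pos_INR.
  - apply pow_le, Cmod_ge_0.
  - apply Rle_trans with (rho ^ pred (N k)).
    + apply pow_incr. unfold rho; lra.
    + apply Rle_pow; [unfold rho; lra|lia]. }
destruct Hd as [d Hd].
exists d. split; [apply is_linear_scal_l|].
intros x Hx. apply (is_filter_lim_locally_unique (K := C_AbsRing) (V := AbsRing_NormedModule C_AbsRing)) in Hx. subst x.
intros eps.
pose proof (Series_correct _ Hb) as HB. set (B := Series b) in HB.
assert (HB0 : 0 <= B).
{ rewrite <- (Rmult_0_l B). unfold B. rewrite <- Series_scal_l.
  apply Series_le; auto. intros k. specialize (Hb0 k). lra. }
(* The 1 keeps w in the disc of radius [rho]; the other bound turns B h^2 into at most eps h, and B
   + 1 avoids dividing by zero. *)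
assert (Hdel : 0 < Rmin 1 (eps / (B + 1))).
{ apply Rmin_pos; [lra|]. apply Rdiv_lt_0_compat; [apply cond_pos|lra]. }
exists (mkposreal _ Hdel). intros w Hw.
change (Cmod (w - z)%C < Rmin 1 (eps / (B + 1))) in Hw.
change (Cmod (f w - f z - (w - z) * d)%C <= eps * Cmod (w - z)%C).
assert (Hw1 : Cmod (w - z)%C < 1) by (eapply Rlt_le_trans; [apply Hw|apply Rmin_l]).
assert (Hw2 : Cmod (w - z)%C < eps / (B + 1))
  by (eapply Rlt_le_trans; [apply Hw|apply Rmin_r]).
assert (Hwr : Cmod w <= rho).
{ replace w with (z + (w - z))%C by ring. unfold rho.
  pose proof (Cmod_triangle z (w - z)%C). lra. }
set (h := Cmod (w - z)%C) in *.
apply Rle_trans with (B * h ^ 2).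
- apply Cmod_series_le with
    (u := fun k => (RtoC (c k) * (w ^ N k - z ^ N k
             - RtoC (INR (N k)) * z ^ pred (N k) * (w - z)))%C)
    (v := fun k => b k * h ^ 2).
  + intros k. rewrite Cmod_mult, Cmod_R, Rabs_pos_eq by auto.
    unfold b. rewrite Rmult_assoc. apply Rmult_le_compat_l; auto.
    apply pow_taylor2; unfold rho; lra || exact Hwr.
  + pose proof (is_series_minus _ _ _ _
      (is_series_minus _ _ _ _ (f_sum w) (f_sum z))
      (is_series_scal_l (K := C_AbsRing) (V := C_NormedModule) (w - z)%C _ _ Hd)) as HS.
    eapply is_series_ext; [|exact HS].
    intros k.
    change ((RtoC (c k) * w ^ N k - RtoC (c k) * z ^ N k
      - (w - z) * (RtoC (c k) * (RtoC (INR (N k)) * z ^ pred (N k))))%C =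
      (RtoC (c k) * (w ^ N k - z ^ N k
             - RtoC (INR (N k)) * z ^ pred (N k) * (w - z)))%C).
    ring.
  + apply (is_series_scal_r (h ^ 2)). exact HB.
- assert (h * (B + 1) <= eps).
  { apply Rlt_le. apply (Rmult_lt_compat_r (B + 1)) in Hw2; [|lra].
    field_simplify in Hw2; [|lra]. lra. }
  assert (0 <= h) by apply Cmod_ge_0. simpl. nra.
Qed.

(** The triangle inequality bounds |f| on the circle by the real series, and the bound is attained
    at z = r, where every term is a nonnegative real. *)
Lemma max_modulus_gap_series (r : R) :
  0 < r -> max_modulus f r = Series (fun k => c k * r ^ N k).
Proof.
intros Hr.
destruct (max_modulus_attained f r entire_gap_series Hr) as [[z [Hz HM]] Hmax].
pose proof (Series_correct _ (conv r (Rlt_le _ _ Hr))) as HS.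
apply Rle_antisym.
- rewrite <- HM. apply (Cmod_series_le _ _ _ _ (fun k => Req_le _ _ (Cmod_gap_term z k))).
  + apply f_sum.
  + rewrite Hz. exact HS.
- set (F := Series _) in *.
  assert (E : f (RtoC r) = RtoC F).
  { apply (filterlim_locally_unique (K := C_AbsRing) (V := C_NormedModule)
      (F := eventually) _ _ _ (f_sum (RtoC r))).
    apply filterlim_ext with (fun n => RtoC (sum_n (fun k => c k * r ^ N k) n)).
    - intros n. induction n as [|n IHn].
      + rewrite !sum_O. rewrite RtoC_mult, RtoC_pow. reflexivity.
      + rewrite !sum_Sn, <- IHn.
        change plus with Rplus at 1. rewrite RtoC_plus, RtoC_mult, RtoC_pow. reflexivity.
    - apply (filterlim_comp _ _ _ _ RtoC _ _ _ HS).
      intros P HP. destruct HP as [e He].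
      exists e. intros y Hy. apply He. split; [exact Hy|].
      apply (ball_center (M := R_UniformSpace)). }
  rewrite <- (Rabs_pos_eq F), <- Cmod_R, <- E.
  + apply Hmax. rewrite Cmod_R. apply Rabs_pos_eq. lra.
  + rewrite <- (Rmult_0_l F). unfold F. rewrite <- Series_scal_l.
    apply Series_le; [|exact (conv r (Rlt_le _ _ Hr))]. intros k.
    assert (0 <= c k * r ^ N k) by (apply Rmult_le_pos; auto; apply pow_le; lra). lra.
Qed.

Lemma gap_term_le_max_modulus (r : R) (k : nat) :
  0 < r -> c k * r ^ N k <= max_modulus f r.
Proof.
intros Hr. rewrite max_modulus_gap_series by exact Hr.
set (u := fun k => c k * r ^ N k).
assert (Hu : forall j, 0 <= u j).
{ intros j. apply Rmult_le_pos; auto. apply pow_le; lra. }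
apply Rle_trans with (sum_n u k).
- destruct k as [|k]; [rewrite sum_O; apply Rle_refl|].
  rewrite sum_Sn. change (u (S k) <= sum_n u k + u (S k)).
  assert (0 <= sum_n u k); [|lra].
  clear -Hu. induction k as [|k IHk]; [rewrite sum_O; auto|].
  rewrite sum_Sn. specialize (Hu (S k)). change plus with Rplus. lra.
- apply (is_lim_seq_incr_compare (sum_n u) (Series u)).
  + exact (Series_correct _ (conv r (Rlt_le _ _ Hr))).
  + intros n. rewrite sum_Sn. specialize (Hu (S n)). change plus with Rplus. lra.
Qed.

(** For r >= 1, a polynomial of degree at most n is bounded by A r^n on |z| = r, whereas a term of
    degree above n forces M(r,f) >= c_k r^(n+1). The radius is chosen so that c_k r > A. *)
Lemma gap_series_not_polynomial :
  (forall k, 0 < c k) -> (forall m, exists k, (m < N k)%nat) -> ~ is_polynomial f.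
Proof.
intros Hc HN [n [a Ha]].
destruct (HN n) as [k Hk]. specialize (Hc k).
set (A := sum_n (fun j => Cmod (a j)) n : R).
set (r := Rmax 1 (A / c k + 1)).
assert (Hr : 1 <= r) by apply Rmax_l.
assert (HAr : A < c k * r).
{ apply Rlt_le_trans with (c k * (A / c k + 1)).
  - replace (c k * (A / c k + 1)) with (A + c k) by (field; lra). lra.
  - apply Rmult_le_compat_l; [lra|apply Rmax_r]. }
assert (Hr0 : 0 < r) by lra.
destruct (max_modulus_attained f r entire_gap_series Hr0) as [[z [Hz HM]] _].
pose proof (gap_term_le_max_modulus r k Hr0) as H1.
assert (H2 : Cmod (f z) <= A * r ^ n).
{ rewrite Ha. unfold A.
  eapply Rle_trans.
  { apply (norm_sum_n_m (K := C_AbsRing) (V := C_NormedModule)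
      (fun j => a j * z ^ j)%C 0 n). }
  change (sum_n_m (fun j => Cmod (a j * z ^ j)%C) 0 n
    <= Rmult (sum_n (fun j => Cmod (a j)) n) (r ^ n)).
  rewrite <- (sum_n_mult_r (K := R_Ring)).
  unfold sum_n. rewrite !sum_n_m_Reals by lia.
  apply sum_Rle. intros j Hj. rewrite Nat.sub_0_r in Hj. simpl Nat.add.
  rewrite Nat.add_0_r, Cmod_mult, Cmod_pow, Hz.
  apply Rmult_le_compat_l; [apply Cmod_ge_0|]. apply Rle_pow; assumption. }
assert (H3 : r ^ S n <= r ^ N k) by (apply Rle_pow; assumption).
assert (H4 : 0 < r ^ n) by (apply pow_lt; exact Hr0).
simpl in H3. nra.
Qed.

End GapSeries.

(** * Upper and lower limits at infinity from eventual or recurring bounds *)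

Lemma LimSup_p_infty_le (g : R -> R) (A c : R) :
  (forall r, A < r -> g r <= c) -> Rbar_le (LimSup_p_infty g) c.
Proof.
intros Hg. unfold LimSup_p_infty, Rbar_glb. destruct Rbar_ex_glb as [l [Hl Hl']]; simpl; clear Hl'.
refine (Rbar_le_trans l _ (Finite c) (Hl _ (ex_intro _ A eq_refl)) _).
apply Lub_Rbar_correct. intros x [r [Hr ->]]. exact (Hg r Hr).
Qed.

Lemma LimSup_p_infty_ge (g : R -> R) (c : R) :
  (forall A, exists r, A < r /\ c <= g r) -> Rbar_le c (LimSup_p_infty g).
Proof.
intros Hg. unfold LimSup_p_infty, Rbar_glb. destruct Rbar_ex_glb as [l [Hl' Hl]]; simpl; clear Hl'.
apply (Hl (Finite c)). intros y [A ->]. destruct (Hg A) as [r [Hr Hc]].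
apply Rbar_le_trans with (Finite (g r)); [exact Hc|].
apply Lub_Rbar_correct. exists r. auto.
Qed.

Lemma LimInf_p_infty_ge (g : R -> R) (A c : R) :
  (forall r, A < r -> c <= g r) -> Rbar_le c (LimInf_p_infty g).
Proof.
intros Hg. unfold LimInf_p_infty, Rbar_lub. destruct Rbar_ex_lub as [l [Hl Hl']]; simpl; clear Hl'.
refine (Rbar_le_trans (Finite c) _ l _ (Hl _ (ex_intro _ A eq_refl))).
apply Glb_Rbar_correct. intros x [r [Hr ->]]. exact (Hg r Hr).
Qed.

Lemma LimInf_p_infty_le (g : R -> R) (c : R) :
  (forall A, exists r, A < r /\ g r <= c) -> Rbar_le (LimInf_p_infty g) c.
Proof.
intros Hg. unfold LimInf_p_infty, Rbar_lub. destruct Rbar_ex_lub as [l [Hl' Hl]]; simpl; clear Hl'.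
apply (Hl (Finite c)). intros y [A ->]. destruct (Hg A) as [r [Hr Hc]].
apply Rbar_le_trans with (Finite (g r)); [|exact Hc].
apply Glb_Rbar_correct. exists r. auto.
Qed.

(** * The degrees N_k and the radii R_k *)

(** The exponent k + s of L_k. It equals 2k at squares and drops to 2k - 2n at k = n^2 + 2n, just
    before the next square. *)
Definition loglog_degree (k : nat) : nat := k + Nat.sqrt k * Nat.sqrt k.
Definition log_degree (k : nat) : nat := 2 ^ loglog_degree k.
Definition degree (k : nat) : nat := 2 ^ log_degree k.
Definition radius (k : nat) : R := 2 ^ (4 ^ k).
Definition coef (k : nat) : R := / radius k ^ degree k.

(** The largest square [<= k] never decreases with k, so the exponent gains at least 1 per step
    despite its oscillation against 2k. *)
Lemma loglog_degree_add (k p : nat) :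
  (loglog_degree k + p <= loglog_degree (k + p))%nat.
Proof.
unfold loglog_degree.
pose proof (Nat.sqrt_le_mono k (k + p) ltac:(lia)).
pose proof (Nat.mul_le_mono _ _ _ _ H H). lia.
Qed.

Lemma log_degree_add (k p : nat) : (2 ^ p * log_degree k <= log_degree (k + p))%nat.
Proof.
unfold log_degree. rewrite <- Nat.pow_add_r. apply Nat.pow_le_mono_r; [lia|].
pose proof (loglog_degree_add k p). lia.
Qed.

Lemma log_degree_gt (k : nat) : (k < log_degree k)%nat.
Proof.
apply Nat.le_lt_trans with (loglog_degree k); [unfold loglog_degree; lia|].
apply Nat.pow_gt_lin_r. lia.
Qed.

Lemma log_degree_le (k : nat) : (log_degree k <= 4 ^ k)%nat.
Proof.
change 4%nat with (2 ^ 2)%nat. rewrite <- Nat.pow_mul_r. apply Nat.pow_le_mono_r; [lia|].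
unfold loglog_degree. pose proof (Nat.sqrt_spec k). lia.
Qed.

Lemma degree_gt (k : nat) : (k < degree k)%nat.
Proof.
apply Nat.lt_trans with (log_degree k); [apply log_degree_gt|].
apply Nat.pow_gt_lin_r. lia.
Qed.

Lemma degree_mono (j k : nat) : (j <= k)%nat -> (degree j <= degree k)%nat.
Proof.
intros H. apply Nat.pow_le_mono_r; [lia|]. replace k with (j + (k - j))%nat by lia.
eapply Nat.le_trans; [|apply log_degree_add].
pose proof (Nat.pow_nonzero 2 (k - j) ltac:(lia)). nia.
Qed.

Lemma INR_degree (k : nat) : INR (degree k) = 2 ^ log_degree k.
Proof. unfold degree. rewrite pow_INR. reflexivity. Qed.

Lemma radius_ge1 (k : nat) : 1 <= radius k.
Proof. apply pow_R1_Rle. lra. Qed.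

Lemma radius_mono (j k : nat) : (j <= k)%nat -> radius j <= radius k.
Proof. intros H. apply Rle_pow; [lra|]. apply Nat.pow_le_mono_r; lia. Qed.

(** The constant 8 serves two estimates: it exceeds e, which makes a term at the next radius large,
    and it exceeds 2, which makes the tail geometric. *)
Lemma radius_lt (j k : nat) : (j < k)%nat -> 8 * radius j <= radius k.
Proof.
intros H. apply Rle_trans with (radius (S j)); [|apply radius_mono; exact H].
unfold radius. replace (8 * 2 ^ (4 ^ j)) with (2 ^ (3 + 4 ^ j)) by (rewrite pow_add; lra).
apply Rle_pow; [lra|]. pose proof (Nat.pow_nonzero 4 j ltac:(lia)).
rewrite Nat.pow_succ_r'. lia.
Qed.

Lemma radius_gt (k : nat) : INR k < radius k.
Proof.
apply Rlt_le_trans with (INR (2 ^ k)).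
- apply lt_INR, Nat.pow_gt_lin_r. lia.
- rewrite pow_INR. apply Rle_pow; [simpl; lra|]. apply Nat.lt_le_incl, Nat.pow_gt_lin_r. lia.
Qed.

Lemma ln_radius (k : nat) : ln (radius k) = 4 ^ k * ln 2.
Proof. unfold radius. rewrite ln_pow, pow_INR by lra. simpl (INR 4). f_equal. f_equal. lra. Qed.

Lemma exists_radius_gt (A : R) : exists k, A < radius k.
Proof.
destruct (INR_unbounded A) as [n Hn]. exists n. pose proof (radius_gt n). lra.
Qed.

(** Reduces an estimate for all large r to one interval between consecutive radii, with an index as
    large as desired. *)
Lemma radius_bracket (p : nat) (r : R) :
  radius p < r -> exists k, (p <= k)%nat /\ radius k < r <= radius (S k).
Proof.
intros Hp. destruct (exists_radius_gt r) as [n Hn].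
assert (H : forall m, r <= radius (p + m) ->
  exists k, (p <= k)%nat /\ radius k < r <= radius (S k)).
{ induction m as [|m IHm]; intros Hm.
  - rewrite Nat.add_0_r in Hm. lra.
  - destruct (Rle_dec r (radius (p + m))) as [H|H]; [exact (IHm H)|].
    exists (p + m)%nat. rewrite <- Nat.add_succ_r. repeat split; [lia|lra|exact Hm]. }
apply (H n). pose proof (radius_mono n (p + n) ltac:(lia)). lra.
Qed.

(** * Coefficients and convergence of the series *)

Lemma coef_gt0 (k : nat) : 0 < coef k.
Proof. apply Rinv_0_lt_compat, pow_lt. pose proof (radius_ge1 k). lra. Qed.

Lemma coef_term (k : nat) (r : R) : coef k * r ^ degree k = (r / radius k) ^ degree k.
Proof. unfold coef, Rdiv. rewrite Rpow_mult_distr, pow_inv. ring. Qed.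

(* The common geometric majorant gives both convergence and the upper bound on
   [M(r,f)]: terms below [k] are at most [R_(k+1)^(N_k)], later ones at most 1. *)
Lemma coef_term_le (k : nat) (r : R) : 0 <= r <= radius (S k) -> forall j,
  coef j * r ^ degree j <= 2 ^ S k * radius (S k) ^ degree k * (1 / 2) ^ j.
Proof.
intros Hr j. rewrite coef_term.
pose proof (radius_ge1 j) as Hj. pose proof (radius_ge1 (S k)) as HSk.
assert (Hq : 0 <= r / radius j) by (apply Rdiv_le_0_compat; lra).
assert (HD : 1 <= radius (S k) ^ degree k) by (apply pow_R1_Rle; lra).
assert (Hh : forall a, 2 ^ a * (1 / 2) ^ a = 1).
{ intros a. rewrite <- Rpow_mult_distr. replace (2 * (1 / 2)) with 1 by lra. apply pow1. }
assert (Hhp : 0 < (1 / 2) ^ j) by (apply pow_lt; lra).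
destruct (Nat.le_gt_cases j (S k)) as [Hjk|Hjk].
- assert (H1 : 1 <= 2 ^ S k * (1 / 2) ^ j).
  { apply Rle_trans with (2 ^ j * (1 / 2) ^ j); [rewrite Hh; lra|].
    apply Rmult_le_compat_r; [lra|]. apply Rle_pow; lra || lia. }
  apply Rle_trans with (radius (S k) ^ degree k); [|nra].
  (* The term of index k + 1 has degree above N_k, but its base r / R_(k+1) is at most 1. *)
  destruct (Nat.eq_dec j (S k)) as [->|Hne].
  + apply Rle_trans with 1; [|exact HD]. rewrite <- (pow1 (degree (S k))).
    apply pow_incr. split; [exact Hq|]. apply Rle_div_l; lra.
  + apply Rle_trans with (radius (S k) ^ degree j).
    * apply pow_incr. split; [exact Hq|]. apply Rle_div_l; [lra|].
      apply Rle_trans with (radius (S k) * 1); [lra|]. apply Rmult_le_compat_l; lra.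
    * apply Rle_pow; [exact HSk|]. apply degree_mono. lia.
- assert (H1 : 1 <= 2 ^ S k) by (apply pow_R1_Rle; lra).
  apply Rle_trans with ((1 / 2) ^ j).
  2:{ rewrite <- (Rmult_1_l ((1 / 2) ^ j)) at 1. apply Rmult_le_compat_r; [lra|].
      rewrite <- (Rmult_1_l 1). apply Rmult_le_compat; lra. }
  apply Rle_trans with ((1 / 2) ^ degree j).
  + apply pow_incr. split; [exact Hq|]. apply Rle_div_l; [lra|].
    pose proof (radius_lt (S k) j Hjk). lra.
  + pose proof (degree_gt j) as Hd. replace (degree j) with (j + (degree j - j))%nat by lia.
    rewrite pow_add.
    assert (H2 : (1 / 2) ^ (degree j - j) <= 1).
    { apply Rle_trans with (1 ^ (degree j - j)); [apply pow_incr; lra|rewrite pow1; lra]. }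
    nra.
Qed.

Lemma is_series_geom_half (a : R) : is_series (fun j => a * (1 / 2) ^ j) (a * 2).
Proof.
replace (a * 2) with (a * / (1 - 1 / 2)) by field.
apply (is_series_scal_l (K := R_AbsRing) (V := R_NormedModule) a (fun j => (1 / 2) ^ j)).
apply is_series_geom. rewrite Rabs_pos_eq; lra.
Qed.

Lemma coef_conv (r : R) : 0 <= r -> ex_series (fun k => coef k * r ^ degree k).
Proof.
intros Hr. destruct (exists_radius_gt r) as [k Hk].
pose proof (radius_mono k (S k) ltac:(lia)) as HS.
apply (ex_series_le (K := R_AbsRing) (V := R_CompleteNormedModule))
  with (fun j => 2 ^ S k * radius (S k) ^ degree k * (1 / 2) ^ j).
- intros j. change (Rabs (coef j * r ^ degree j)
    <= 2 ^ S k * radius (S k) ^ degree k * (1 / 2) ^ j).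
  rewrite Rabs_pos_eq; [apply coef_term_le; lra|].
  apply Rmult_le_pos; [apply Rlt_le, coef_gt0|apply pow_le, Hr].
- eexists. apply is_series_geom_half.
Qed.

Lemma coef_complex_conv (z : C) : exists l : C,
  is_series (K := C_AbsRing) (V := C_NormedModule)
    (fun k => RtoC (coef k) * z ^ degree k)%C l.
Proof.
apply (ex_series_le (K := C_AbsRing) (V := C_CompleteNormedModule))
  with (fun k => coef k * Cmod z ^ degree k); [|apply coef_conv, Cmod_ge_0].
intros k. change (Cmod (RtoC (coef k) * z ^ degree k)%C <= coef k * Cmod z ^ degree k).
rewrite Cmod_gap_term by (intros; apply Rlt_le, coef_gt0). lra.
Qed.

(** * Growth of log M(r,f) and log log M(r,f) *)

Lemma ln2_gt0 : 0 < ln 2.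
Proof. rewrite <- ln_1. apply ln_increasing; lra. Qed.

Lemma ln2_lt1 : ln 2 < 1.
Proof.
rewrite <- (ln_exp 1). apply ln_increasing; [lra|].
pose proof (exp_ineq1 1 ltac:(lra)). lra.
Qed.

Lemma ln_radius_gt0 (k : nat) : 0 < ln (radius k).
Proof.
rewrite ln_radius. apply Rmult_lt_0_compat; [apply pow_lt; lra|exact ln2_gt0].
Qed.

Section Growth.

Context (f : C -> C)
  (f_sum : forall z, is_series (K := C_AbsRing) (V := C_NormedModule)
    (fun k => RtoC (coef k) * z ^ degree k)%C (f z)).

Let coef_ge0 (k : nat) : 0 <= coef k := Rlt_le _ _ (coef_gt0 k).

(* The [k]-th term at [R_(k+1)] is already at least [e^(N_k)]. *)
Lemma ln_max_modulus_ge (k : nat) (r : R) :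
  radius (S k) <= r -> 2 ^ log_degree k <= ln (max_modulus f r).
Proof.
intros Hr. pose proof (radius_ge1 k) as Hk. pose proof (radius_lt k (S k) ltac:(lia)) as HS.
assert (Hr0 : 0 < r) by lra.
rewrite <- INR_degree, <- (Rmult_1_r (INR _)), <- (ln_exp 1) at 1.
rewrite <- ln_pow by apply exp_pos.
apply ln_le; [apply pow_lt, exp_pos|].
eapply Rle_trans; [|apply (gap_term_le_max_modulus _ _ _ coef_ge0 coef_conv f_sum r k Hr0)].
rewrite coef_term. apply pow_incr. split; [apply Rlt_le, exp_pos|].
apply Rle_trans with 3; [exact exp_le_3|]. apply Rle_div_r; lra.
Qed.

Lemma ln_max_modulus_gt0 (r : R) : radius 1 <= r -> 0 < ln (max_modulus f r).
Proof.
intros Hr. eapply Rlt_le_trans; [|apply (ln_max_modulus_ge 0), Hr].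
apply pow_lt. lra.
Qed.

Lemma max_modulus_gt0 (r : R) : 0 < r -> 0 < max_modulus f r.
Proof.
intros Hr.
eapply Rlt_le_trans; [|apply (gap_term_le_max_modulus _ _ _ coef_ge0 coef_conv f_sum r 0 Hr)].
apply Rmult_lt_0_compat; [apply coef_gt0|apply pow_lt, Hr].
Qed.

(** Summing the geometric majorant gives M(r,f) <= 2^(k+2) R_(k+1)^(N_k), whose logarithm is at most
    4^(k+1) (1 + N_k). This is rounded up to a power of 2, so that the next logarithm is exact. *)
Lemma ln_max_modulus_le (k : nat) (r : R) :
  0 < r <= radius (S k) -> ln (max_modulus f r) <= 2 ^ (2 * k + 4 + log_degree k).
Proof.
intros Hr. pose proof (radius_ge1 (S k)) as HS.
assert (HD : 0 < radius (S k) ^ degree k) by (apply pow_lt; lra).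
assert (H2 : 0 < 2 ^ S (S k)) by (apply pow_lt; lra).
apply Rle_trans with (ln (2 ^ S (S k) * radius (S k) ^ degree k)).
- apply ln_le; [apply max_modulus_gt0; lra|].
  rewrite (max_modulus_gap_series _ _ _ coef_ge0 coef_conv f_sum) by lra.
  replace (2 ^ S (S k) * radius (S k) ^ degree k)
    with (2 ^ S k * radius (S k) ^ degree k * 2) by (simpl; ring).
  rewrite <- (is_series_unique _ _ (is_series_geom_half _)).
  apply Series_le; [|eexists; apply is_series_geom_half].
  intros j. split; [|apply coef_term_le; lra].
  apply Rmult_le_pos; [apply coef_ge0|apply pow_le; lra].
- rewrite ln_mult, !ln_pow, ln_radius, INR_degree by lra.
  pose proof ln2_gt0 as Hl. pose proof ln2_lt1 as Hl1.
  assert (E4 : 4 ^ S k = 2 ^ (2 * S k)) by (rewrite pow_mult; f_equal; ring).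
  assert (HL : 1 <= 2 ^ log_degree k) by (apply pow_R1_Rle; lra).
  assert (Hk : INR (S (S k)) <= 4 ^ S k).
  { replace 4 with (INR 4) by (simpl; lra). rewrite <- pow_INR. apply le_INR.
    pose proof (Nat.pow_gt_lin_r 4 (S k) ltac:(lia)). lia. }
  assert (H4 : 1 <= 4 ^ S k) by (apply pow_R1_Rle; lra).
  replace (2 ^ (2 * k + 4 + log_degree k)) with (4 * 4 ^ S k * 2 ^ log_degree k).
  2:{ rewrite E4. replace (2 * k + 4 + log_degree k)%nat with (2 + 2 * S k + log_degree k)%nat
        by lia. rewrite !pow_add. simpl (2 ^ 2). ring. }
  apply Rle_trans with (4 ^ S k * 1 + 2 ^ log_degree k * (4 ^ S k * 1)).
  + apply Rplus_le_compat; [|apply Rmult_le_compat_l; [lra|]].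
    * apply Rmult_le_compat; try lra. apply pos_INR.
    * apply Rmult_le_compat_l; lra.
  + nra.
Qed.

Lemma lnln_max_modulus_ge (k : nat) (r : R) :
  radius (S k) <= r -> INR (log_degree k) * ln 2 <= ln (ln (max_modulus f r)).
Proof.
intros Hr. rewrite <- ln_pow by lra. apply ln_le; [apply pow_lt; lra|].
apply ln_max_modulus_ge, Hr.
Qed.

Lemma lnln_max_modulus_le (k : nat) (r : R) :
  radius 1 <= r <= radius (S k) ->
  ln (ln (max_modulus f r)) <= (INR (2 * k + 4) + INR (log_degree k)) * ln 2.
Proof.
intros Hr. pose proof (radius_ge1 1). rewrite <- plus_INR, <- ln_pow by lra.
apply ln_le; [apply ln_max_modulus_gt0|apply ln_max_modulus_le]; lra.
Qed.

(** Between R_k and R_(k+1), log log M is at most (2k + 4 + L_k) log 2 and log r is at least 4^k log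
    2. The 5 comes from 2k + 4 <= 4 * 4^k and L_k <= 4^k. *)
Lemma order_le : Rbar_le (order f) 5.
Proof.
apply (LimSup_p_infty_le _ (radius 1)). intros r Hr.
destruct (radius_bracket 1 r Hr) as [k [Hk [Hr1 Hr2]]].
pose proof (radius_ge1 k). pose proof (ln_radius_gt0 k) as Hl0.
assert (Hl : ln (radius k) <= ln r) by (apply ln_le; lra).
apply Rle_div_l; [lra|].
apply Rle_trans with (5 * ln (radius k)); [|lra].
eapply Rle_trans; [apply (lnln_max_modulus_le k); lra|].
rewrite ln_radius, <- Rmult_assoc. apply Rmult_le_compat_r; [apply Rlt_le, ln2_gt0|].
replace (5 * 4 ^ k) with (INR (5 * 4 ^ k)) by (rewrite mult_INR, pow_INR; simpl; f_equal; [lra|f_equal; lra]).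
rewrite <- plus_INR. apply le_INR.
pose proof (log_degree_le k). pose proof (Nat.pow_gt_lin_r 4 k ltac:(lia)). lia.
Qed.

(** At r = R_(k+1) with k a square, log log M >= 4^k log 2 while log r = 4^(k+1) log 2; the quotient
    is at least 1/4. *)
Lemma order_ge : Rbar_le (1 / 4) (order f).
Proof.
apply LimSup_p_infty_ge. intros A.
destruct (exists_radius_gt A) as [n Hn]. set (k := (n * n)%nat).
assert (E : log_degree k = (4 ^ k)%nat).
{ unfold log_degree, loglog_degree. unfold k at 2 3. rewrite Nat.sqrt_square. fold k.
  change 4%nat with (2 ^ 2)%nat. rewrite <- Nat.pow_mul_r. f_equal. lia. }
exists (radius (S k)). split.
- eapply Rlt_le_trans; [exact Hn|]. apply radius_mono. unfold k. nia.
- apply (Rle_div_r (1 / 4) _ _ (ln_radius_gt0 (S k))).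
  eapply Rle_trans; [|apply (lnln_max_modulus_ge k); lra].
  rewrite ln_radius, E, pow_INR. simpl (INR 4). replace (1 + 1 + 1 + 1) with 4 by lra.
  simpl. lra.
Qed.

Lemma lower_order_ge : Rbar_le 0 (lower_order f).
Proof.
apply (LimInf_p_infty_ge _ (radius 1)). intros r Hr.
pose proof (ln_radius_gt0 1). pose proof (radius_ge1 1).
assert (Hl : ln (radius 1) <= ln r) by (apply ln_le; lra).
apply Rle_div_r; [lra|]. rewrite Rmult_0_l.
eapply Rle_trans; [|apply (lnln_max_modulus_ge 0); lra].
apply Rmult_le_pos; [apply pos_INR|apply Rlt_le, ln2_gt0].
Qed.

Lemma lower_order_le (e : R) : 0 < e -> Rbar_le (lower_order f) e.
Proof.
intros He. apply LimInf_p_infty_le. intros A.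
destruct (exists_radius_gt A) as [n0 Hn0].
(* At r = R_(k+1) the quotient will be at most 9/n, hence n above 9/e; the summand [n0] pushes the
   radius beyond A. *)
destruct (INR_unbounded (9 / e)) as [n1 Hn1].
set (n := (n0 + n1)%nat). set (k := (n * n + 2 * n)%nat).
assert (E : (4 ^ n * log_degree k = 4 ^ k)%nat).
{ unfold log_degree, loglog_degree.
  rewrite (Nat.sqrt_unique k n) by (unfold k; lia).
  change 4%nat with (2 ^ 2)%nat. rewrite <- !Nat.pow_mul_r, <- Nat.pow_add_r.
  f_equal. unfold k. lia. }
pose proof (radius_mono 1 (S k) ltac:(lia)) as H1S.
exists (radius (S k)). split.
- eapply Rlt_le_trans; [exact Hn0|]. apply radius_mono. unfold k, n. nia.
- apply Rle_div_l; [apply ln_radius_gt0|].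
  eapply Rle_trans; [apply (lnln_max_modulus_le k); lra|].
  rewrite ln_radius, <- Rmult_assoc. apply Rmult_le_compat_r; [apply Rlt_le, ln2_gt0|].
  (* The part n L_k is at most 4^n L_k = 4^k; the part n (2k + 4) is absorbed through n <= k < 2^k
     and 4^k = 2^k * 2^k. The 9 is crude. *)
  assert (Hb : (n * (2 * k + 4 + log_degree k) <= 9 * 4 ^ k)%nat).
  { pose proof (Nat.pow_gt_lin_r 4 n ltac:(lia)) as P1.
    pose proof (Nat.pow_gt_lin_r 2 k ltac:(lia)) as P2.
    assert (P3 : (4 ^ k = 2 ^ k * 2 ^ k)%nat).
    { rewrite <- Nat.pow_add_r. change 4%nat with (2 ^ 2)%nat.
      rewrite <- Nat.pow_mul_r. f_equal. lia. }
    assert (P4 : (n <= k)%nat) by (unfold k; nia).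
    assert (n * log_degree k <= 4 ^ k)%nat by (rewrite <- E; nia).
    nia. }
  apply le_INR in Hb. rewrite !mult_INR, plus_INR, pow_INR in Hb.
  simpl (INR 9) in Hb. simpl (INR 4) in Hb.
  replace (1 + 1 + 1 + 1) with 4 in Hb by lra.
  set (X := INR (2 * k + 4) + INR (log_degree k)) in *.
  assert (Hn : 9 < e * INR n).
  { unfold n. rewrite plus_INR. pose proof (pos_INR n0).
    apply (Rmult_lt_compat_l e) in Hn1; [|lra].
    replace (e * (9 / e)) with 9 in Hn1 by (field; lra). nra. }
  assert (H4 : 0 < 4 ^ k) by (apply pow_lt; lra).
  assert (HX : 9 * X <= 9 * (e * 4 ^ k)).
  { assert (0 <= X) by (unfold X; pose proof (pos_INR (2 * k + 4));
      pose proof (pos_INR (log_degree k)); lra).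
    apply Rle_trans with (e * INR n * X); [nra|].
    apply (Rmult_le_compat_l e) in Hb; lra. }
  simpl. nra.
Qed.

Lemma gap_series_strongly_log_regular : strongly_log_regular f.
Proof.
intros eps Heps. set (m := 1 / eps).
assert (Hm : 0 < m) by (apply Rdiv_lt_0_compat; lra).
(* The right-hand side will be at most 2^(7 m L_k) and the left at least 2^(2^p L_k), so [p] is
   taken with 2^p >= 7m. *)
destruct (INR_unbounded (7 * m)) as [p Hp].
assert (Hp2 : 7 * m <= 2 ^ p).
{ replace 2 with (INR 2) by (simpl; lra). rewrite <- pow_INR.
  apply Rlt_le. eapply Rlt_trans; [exact Hp|]. apply lt_INR, Nat.pow_gt_lin_r. lia. }
(* Beyond R_(p+1) the bracketing index k is at least p + 1, which lets L_k absorb the factor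
   4^(p+1). *)
exists (radius (S p)), (INR (4 ^ S p)).
assert (E4 : INR (4 ^ S p) = 2 ^ (2 * S p)).
{ rewrite pow_INR, pow_mult. f_equal. simpl; lra. }
assert (H4 : (1 < 4 ^ S p)%nat).
{ pose proof (Nat.pow_gt_lin_r 4 (S p) ltac:(lia)). lia. }
pose proof (radius_ge1 (S p)) as HRp.
split; [lra|]. split; [apply (lt_INR 1), H4|].
intros r Hr. apply Rle_ge.
destruct (radius_bracket (S p) r Hr) as [k [Hk [Hr1 Hr2]]].
pose proof (radius_mono 1 (S p) ltac:(lia)) as HR1. pose proof (radius_ge1 k) as HRk.
(* The power 4^(p+1) sends R_k exactly to R_(k+p+1), so the term of index k + p bounds M from
   below. *)
assert (Hlow : 2 ^ log_degree (k + p) <= ln (max_modulus f (Rpower r (INR (4 ^ S p))))).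
{ apply ln_max_modulus_ge. rewrite Rpower_pow by lra.
  replace (radius (S (k + p))) with (radius k ^ (4 ^ S p)).
  - apply pow_incr. lra.
  - unfold radius. rewrite <- pow_mult, <- Nat.pow_add_r. f_equal. f_equal. lia. }
eapply Rle_trans; [|exact Hlow].
pose proof (ln_max_modulus_gt0 r ltac:(lra)) as Hpos.
pose proof (ln_max_modulus_le k r ltac:(lra)) as Hup.
(* All the linear terms are absorbed by L_k, because p + 1 <= k < L_k. *)
assert (HX : (2 * S p + (2 * k + 4 + log_degree k) <= 7 * log_degree k)%nat).
{ pose proof (log_degree_gt k). lia. }
apply Rle_trans with (Rpower (2 ^ (7 * log_degree k)) m).
- apply Rle_Rpower_l; [lra|]. split.
  + apply Rmult_lt_0_compat; [apply lt_0_INR; lia|exact Hpos].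
  + eapply Rle_trans; [|apply Rle_pow; [lra|exact HX]].
    rewrite E4, pow_add. apply Rmult_le_compat_l; [apply pow_le; lra|exact Hup].
- rewrite <- !Rpower_pow by lra. rewrite Rpower_mult. apply Rle_Rpower; [lra|].
  apply Rle_trans with (INR (2 ^ p * log_degree k)); [|apply le_INR, log_degree_add].
  rewrite !mult_INR, pow_INR. pose proof (pos_INR (log_degree k)).
  simpl (INR 2). simpl (INR 7). replace (1 + 1) with 2 by lra. nra.
Qed.

End Growth.

(** * The example function and its properties *)

Theorem mainTheorem7 :
  exists f : C -> C,
    transcendental_entire f /\
    lower_order f = Finite 0 /\
    Rbar_lt (Finite 0) (order f) /\ Rbar_lt (order f) p_infty /\
    strongly_log_regular f.
Proof.
(* Convergence only asserts that a sum exists at each z, so its value is picked by a description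
   operator. *)
set (f := fun z => proj1_sig (constructive_indefinite_description _ (coef_complex_conv z))).
assert (Hf : forall z, is_series (K := C_AbsRing) (V := C_NormedModule)
    (fun k => RtoC (coef k) * z ^ degree k)%C (f z)).
{ intros z. exact (proj2_sig (constructive_indefinite_description _ (coef_complex_conv z))). }
assert (Hc : forall k, 0 <= coef k) by (intros k; apply Rlt_le, coef_gt0).
exists f. split; [split|split; [|split; [|split]]].
- exact (entire_gap_series _ _ _ Hc coef_conv Hf).
- apply (gap_series_not_polynomial _ _ _ Hc coef_conv Hf coef_gt0).
  intros m. exists m. apply degree_gt.
- pose proof (lower_order_ge f Hf) as H0.
  pose proof (lower_order_le f Hf) as H1.
  (* The value +oo contradicts the bound for e = 1, and -oo contradicts the lower bound 0. *)
  destruct (lower_order f) as [l| |]; simpl in H0, H1.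
  + f_equal. apply Rle_antisym; [|exact H0]. apply le_epsilon. intros e He.
    rewrite Rplus_0_l. exact (H1 e He).
  + destruct (H1 1 Rlt_0_1).
  + destruct H0.
- apply Rbar_lt_le_trans with (Finite (1 / 4)); [simpl; lra|exact (order_ge f Hf)].
- apply Rbar_le_lt_trans with (Finite 5); [exact (order_le f Hf)|exact I].
- exact (gap_series_strongly_log_regular f Hf).
Qed.
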